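(* Let $d>1$, $n\ge2$, and let $w\in G(d,1,n)$. Then the word $RE(w)$ is a reduced expression over $\mathbf{X}$ of $w$.
   Context: Let $\zeta_d=\exp(2\pi i/d)$. $G(d,1,n)$ is the group of $n\times n$ monomial matrices whose nonzero entries are $d$-th roots of unity. Generators: $z=\mathrm{Diag}(\zeta_d,1,\dots,1)$ and, for $2\le j\le n$, $s_j$ the permutation matrix of the transposition $(j-1,j)$. Let $\mathbf{X}=\{\mathbf{z},\mathbf{s}_2,\dots,\mathbf{s}_n\}$ be the corresponding alphabet of formal letters. A word over $\mathbf{X}$ is a finite sequence of letters of $\mathbf{X}$ (no inverses); it represents $w$ if the product of the corresponding matrices is $w$. A reduced expression over $\mathbf{X}$ of $w$ is a word over $\mathbf{X}$ representing $w$ of minimal length among all such words. The word $RE(w)$: put $w_n:=w$. For $i=n,n-1,\dots,2$, $w_i$ is an $i\times i$ monomial matrix; let $c$ be the unique column with $w_i[i,c]\ne0$; $w_{i-1}$ is obtained from $w_i$ by removing row $i$ and column $c$. Then $w_1=\zeta_d^k$ for a unique $0\le k\le d-1$, and $RE_1(w):=\mathbf{z}^k$. For $2\le i\le n$: if $w_i[i,c]=1$, then $RE_i(w):=\mathbf{s}_i\mathbf{s}_{i-1}\cdots\mathbf{s}_{c+1}$ (decreasing indices, empty if $c=i$); if $w_i[i,c]=\zeta_d^k$ with $1\le k\le d-1$, then $RE_i(w)$ is $\mathbf{s}_i\cdots\mathbf{s}_3\mathbf{s}_2\mathbf{z}^k$ if $c=1$ and $\mathbf{s}_i\cdots\mathbf{s}_3\mathbf{s}_2\mathbf{z}^k\mathbf{s}_2\mathbf{s}_3\cdots\mathbf{s}_c$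 if $c\ge2$. Here $\mathbf{z}^0$ is the empty word. Finally $RE(w):=RE_1(w)RE_2(w)\cdots RE_n(w)$. *)

(* Defs.v *)
From HB Require Import structures.
From mathcomp Require Import all_boot all_order all_algebra.
From mathcomp Require Import all_real_closed.
From mathcomp Require Import reals trigo.

Set Implicit Arguments.
Unset Strict Implicit.
Unset Printing Implicit Defensive.

Import Order.TTheory GRing.Theory Num.Theory.
Local Open Scope ring_scope.
Local Open Scope complex_scope.

(* All row, column and letter indices named in comments are 1-based, as in
   the usual notation for G(d,1,n); elements of 'I_n are 0-based. *)

(* exp (2 pi i / d), by Euler's formula. *)
Definition zeta (R : realType) (d : nat) : R[i] :=
  cos (2 * pi / d%:R) +i* sin (2 * pi / d%:R).

Definition monomial_mx (C : fieldType) (n : nat) (w : 'M[C]_n) : Prop :=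
  (forall i, exists! j, w i j != 0) /\ (forall j, exists! i, w i j != 0).

Definition in_Gd1n (C : fieldType) (d n : nat) (w : 'M[C]_n) : Prop :=
  monomial_mx w /\ (forall i j, w i j != 0 -> d.-unity_root (w i j)).

(* Formal letters, shared by all n; [alphabet n] selects those of the
   alphabet {z, s_2, ..., s_n}. *)
Inductive letter : Type := Lz | Ls of nat.

Definition word := seq letter.

Definition alphabet (n : nat) (l : letter) : bool :=
  if l is Ls j then (2 <= j <= n)%N else true.

Definition z_mx (R : realType) (d n : nat) : 'M[R[i]]_n :=
  diag_mx (\row_(j < n) if j == 0%N :> nat then zeta R d else 1).

(* Permutation matrix of the transposition (j-1, j), for 2 <= j <= n. *)
Definition s_mx (R : realType) (n j : nat) : 'M[R[i]]_n :=
  \matrix_(a < n, b < n)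
    (b.+1 == [fun k => k with j.-1 |-> j, j |-> j.-1] a.+1)%:R.

Definition letter_mx (R : realType) (d n : nat) (l : letter) : 'M[R[i]]_n :=
  match l with Lz => z_mx R d n | Ls j => s_mx R n j end.

Definition word_mx (R : realType) (d n : nat) (u : word) : 'M[R[i]]_n :=
  \prod_(l <- u) letter_mx R d n l.

Definition represents (R : realType) (d n : nat) (u : word) (w : 'M[R[i]]_n) :
    Prop :=
  all (alphabet n) u /\ word_mx R d n u = w.

Definition reduced_expression (R : realType) (d n : nat) (u : word)
    (w : 'M[R[i]]_n) : Prop :=
  represents d u w /\ (forall v : word, represents d v w -> (size u <= size v)%N).

(* s_a s_(a+1) ... s_b and s_b s_(b-1) ... s_a; both are empty if b < a. *)
Definition s_up (a b : nat) : word := [seq Ls j | j <- index_iota a b.+1].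
Definition s_down (b a : nat) : word := rev (s_up a b).

Definition z_pow (k : nat) : word := nseq k Lz.

(* The k with 0 <= k < d and x = zeta_d ^ k; the default 0 is only reached
   when x is not a d-th root of unity. *)
Definition zeta_log (R : realType) (d : nat) (x : R[i]) : nat :=
  if [pick k : 'I_d | x == zeta R d ^+ k] is Some k then k : nat else 0%N.

(* The column of the nonzero entry of the last row; the default is only
   reached when that row is zero. *)
Definition last_row_col (C : fieldType) (m : nat) (w : 'M[C]_m.+1) : 'I_m.+1 :=
  odflt ord_max [pick c | w ord_max c != 0].

(* RE_i(w), read off the i x i matrix w_i, for i >= 2. *)
Definition RE_block (R : realType) (d m : nat) (w : 'M[R[i]]_m.+1) : word :=
  let i := m.+1 in
  let c := last_row_col w in
  let c1 := c.+1 in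
  let x := w ord_max c in
  if x == 1 then s_down i c1.+1
  else if c1 == 1%N then s_down i 2 ++ z_pow (zeta_log d x)
  else s_down i 2 ++ z_pow (zeta_log d x) ++ s_up 2 c1.

(* RE(w_i) = RE_1(w) ... RE_i(w), where w_(i-1) is w_i without its last row
   and the column of the nonzero entry of that row. *)
Fixpoint RE (R : realType) (d n : nat) : 'M[R[i]]_n -> word :=
  match n return 'M[R[i]]_n -> word with
  | 0 => fun _ => [::]
  | m.+1 => match m return ('M[R[i]]_m -> word) -> 'M[R[i]]_m.+1 -> word with
    | 0 => fun _ w => z_pow (zeta_log d (w ord0 ord0))
    | m'.+1 => fun REm w =>
        REm (row' ord_max (col' (last_row_col w) w)) ++ RE_block d w
    end (@RE R d m)
  end.

(* Main.v *)
Require Import Defs.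
From mathcomp Require Import all_boot all_order all_algebra all_fingroup.
From mathcomp Require Import all_real_closed zify ring.
From mathcomp Require Import reals trigo.

Set Implicit Arguments.
Unset Strict Implicit.
Unset Printing Implicit Defensive.

Import Order.TTheory GRing.Theory Num.Theory.
Local Open Scope ring_scope.
Local Open Scope complex_scope.

(** A monomial matrix w is recorded by its column function c and its exponents
    k, and mono_length is the statistic
      sum_i k_i + #{r < i : c_r > c_i} + 2 #{r < i : c_r < c_i, k_i <> 0}.
    Splitting off the last row shows that RE(w) represents w and has this
    length. Conversely, mono_length vanishes at the identity, and left
    multiplication by a letter raises it by at most one: z only adds one to the
    first exponent, modulo d, and s_j exchanges two adjacent rows, so that only
    the contribution of that pair of rows changes, from 0 or 2 to 1 or back.
    Hence every word representing w has at least mono_length(w) letters. *)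

(** * Powers of [zeta] *)

Lemma zetaX (R : realType) (d k : nat) :
  zeta R d ^+ k =
  cos (2 * pi / d%:R *+ k) +i* sin (2 * pi / d%:R *+ k).
Proof.
elim: k => [|k IH]; first by rewrite expr0 mulr0n cos0 sin0.
rewrite exprS IH /zeta (mulrS _ k) cosD sinD; apply/eqP.
by rewrite eq_complex /= eqxx /= addrC eqxx.
Qed.

(** By the half-angle formula [cos t = 1 - 2 sin^2 (t/2)], and the sine is positive at [t/2], which
    lies strictly between 0 and [pi]. *)
Lemma cos_lt1 (R : realType) (t : R) : 0 < t < pi *+ 2 -> cos t != 1.
Proof.
move=> /andP[t0 t2].
have s0 : 0 < sin (t / 2).
  apply: sin_gt0_pi; rewrite divr_gt0 // ltr_pdivrMr //.
  by rewrite mulr_natr.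
have -> : t = (t / 2) *+ 2 by rewrite -mulr_natr divfK // pnatr_eq0.
rewrite cos_mulr2n cos2sin2.
have -> : (1 - sin (t / 2) ^+ 2) *+ 2 - 1 = 1 - sin (t / 2) ^+ 2 *+ 2 by ring.
by rewrite -subr_eq0 addrC addKr oppr_eq0 mulrn_eq0 /= expf_eq0 /= gt_eqF.
Qed.

Lemma zeta_prim (R : realType) (d : nat) :
  (0 < d)%N -> d.-primitive_root (zeta R d).
Proof.
move=> d0; have d0R : (d%:R : R) != 0 by rewrite pnatr_eq0 -lt0n.
rewrite /primitive_root_of_unity d0 /=; apply/forallP => i.
rewrite unity_rootE zetaX; apply/eqP.
case: (ltnP i.+1 d) => [lt_id|ge_id].
  rewrite (ltn_eqF lt_id); apply/negbTE.
  rewrite eq_complex /= negb_and cos_lt1 //.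
  have -> : 2 * pi / d%:R *+ i.+1 = pi *+ 2 * (i.+1%:R / d%:R) :> R by ring.
  have pi2 : 0 < pi *+ 2 :> R by rewrite pmulrn_lgt0 ?pi_gt0.
  rewrite (gtr_pMr _ pi2) pmulr_rgt0 // divr_gt0 ?ltr0n //=.
  by rewrite ltr_pdivrMr ?ltr0n // mul1r ltr_nat.
have -> : i.+1 = d by apply/eqP; rewrite eqn_leq ge_id ltn_ord.
rewrite -mulr_natr divfK // mulr_natl cos2pi sin2pi eqxx.
by apply/eqP.
Qed.

Lemma zeta_logX (R : realType) (d : nat) (k : 'I_d) :
  zeta_log d (zeta R d ^+ k) = k.
Proof.
have pz := zeta_prim R (leq_ltn_trans (leq0n k) (ltn_ord k)).
rewrite /zeta_log; case: pickP => [k'|/(_ k)]; last by rewrite eqxx.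
by rewrite (eq_prim_root_expr pz) !modn_small // => /eqP.
Qed.

(** * The length statistic and its variation *)

(* Cost of the pair of rows [r < i] of a monomial matrix whose nonzero entries
   lie in columns [a] and [b], the entry of row [i] being [zeta ^ k]. *)
Definition pair_cost (a b k : nat) : nat :=
  (if b < a then 1 else if k == 0 then 0 else 2)%N.

Definition mono_length (n d : nat) (c : 'I_n -> 'I_n) (k : 'I_n -> 'I_d) :
    nat :=
  (\sum_i k i +
   \sum_(i < n) \sum_(r < n | (r < i)%N) pair_cost (c r) (c i) (k i))%N.

(** Reindexing by an adjacent transposition permutes the increasing pairs, except that [(p, q)]
    becomes decreasing. The extra term on each side replaces a subtraction in [nat]. *)
Lemma sum_ltn_pairs_tperm (n : nat) (p q : 'I_n) (F : 'I_n -> 'I_n -> nat) :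
  q = p.+1 :> nat ->
  (\sum_(i < n) \sum_(r < n | (r < i)%N) F (tperm p q r) (tperm p q i) + F p q =
   \sum_(i < n) \sum_(r < n | (r < i)%N) F r i + F q p)%N.
Proof.
move=> qp; rewrite !pair_big_dep /=.
pose h (x : 'I_n * 'I_n) := (tperm p q x.1, tperm p q x.2).
rewrite (reindex_inj (h := h)) /=; last
  by move=> [a b] [a' b'] /= [/perm_inj-> /perm_inj->].
under eq_bigr do rewrite !tpermK.
rewrite (bigD1 (p, q)) /= ?tpermL ?tpermR ?qp //.
rewrite [in RHS](bigD1 (q, p)) /= ?qp //.
rewrite addnAC [RHS]addnAC (addnC (F q p)); congr (_ + _)%N.
apply: eq_bigl => -[i r] /=; rewrite !xpair_eqE.
have pq : p != q by apply/eqP => /(congr1 val) /=; lia.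
(* No index lies strictly between [p] and [q], so exchanging them does not affect their order
   relative to a third index. *)
case: (tpermP p q i) => [->|->|/eqP ip /eqP iq];
case: (tpermP p q r) => [->|->|/eqP rp /eqP rq];
  rewrite ?eqxx ?(eq_sym q) ?(negbTE pq) ?ltnn ?andbF ?andbT //=;
  rewrite ?(negbTE ip) ?(negbTE iq) ?(negbTE rp) ?(negbTE rq)
    ?andbF ?andbT //= ?qp //;
  try (by apply/idP/idP; lia).
- by move: rp rq; rewrite -!val_eqE /=; lia.
- by move: rp rq; rewrite -!val_eqE /=; lia.
- by move: ip iq; rewrite -!val_eqE /=; lia.
- by move: ip iq; rewrite -!val_eqE /=; lia.
Qed.

Lemma mono_length_tperm (n d : nat) (c : 'I_n -> 'I_n) (k : 'I_n -> 'I_d)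
    (p q : 'I_n) :
  injective c -> q = p.+1 :> nat ->
  (mono_length (c \o tperm p q) (k \o tperm p q) <= (mono_length c k).+1)%N.
Proof.
move=> cI qp; rewrite /mono_length.
have -> : (\sum_i (k \o tperm p q) i = \sum_i k i)%N.
  by rewrite [RHS](reindex_inj (@perm_inj _ (tperm p q))).
rewrite -addnS leq_add2l.
have := sum_ltn_pairs_tperm (fun r i => pair_cost (c r) (c i) (k i)) qp.
have c_pq : c p != c q :> nat.
  by apply/eqP => /val_inj /cI /(congr1 val) /=; lia.
(* The two columns differ, so one of these costs is that of an inversion, 1, and the other is 0 or
   2. *)
have : (pair_cost (c q) (c p) (k p) <= (pair_cost (c p) (c q) (k q)).+1)%N.
  by move: c_pq; rewrite /pair_cost; case: ltngtP => //= _ _; case: ifP.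
by rewrite /=; lia.
Qed.

Lemma mono_length_id (n d : nat) (k : 'I_n -> 'I_d) :
  (forall i, k i = 0 :> nat)%N -> mono_length id k = 0%N.
Proof.
move=> k0; rewrite /mono_length !big1 // => i _; rewrite big1 // => r ri.
by rewrite /pair_cost k0 ltnNge (ltnW ri).
Qed.

(** A pair cost involves only the exponent of its lower row, and the first row is never the lower
    one; hence only the sum of the exponents can change. *)
Lemma mono_length_row0 (n d : nat) (c : 'I_n.+1 -> 'I_n.+1)
    (k k' : 'I_n.+1 -> 'I_d) :
  (forall i, i != ord0 -> k' i = k i) -> (k' ord0 <= (k ord0).+1)%N ->
  (mono_length c k' <= (mono_length c k).+1)%N.
Proof.
move=> kk k0; rewrite /mono_length -addSn; apply: leq_add.
  rewrite !(bigD1 (P := predT) ord0) //= -addSn leq_add //.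
  by rewrite (eq_bigr (fun i => k i : nat)) // => i /kk ->.
apply: leq_sum => i _; apply: leq_sum => r ri; rewrite kk //.
by rewrite -val_eqE /=; lia.
Qed.

(** The [n - j] columns to the right of [j] cost 1 each; the [j] columns to its left cost 0 or 2
    each, according to [k]. *)
Lemma sum_pair_cost_lift (n : nat) (j : 'I_n.+1) (k : nat) :
  (\sum_(b < n) pair_cost (lift j b) j k = if k == 0 then n - j else n + j)%N.
Proof.
have jn : (j <= n)%N by rewrite -ltnS.
under eq_bigr => b _ do rewrite /pair_cost /= leq_bump /unbump ltnSn subn1 /=.
rewrite -(big_mkord predT (fun b => if j <= b then 1 else _)%N).
rewrite (big_cat_nat (n := j)) //=.
rewrite (eq_big_nat _ _ (F2 := fun=> if k == 0 then 0 else 2)%N);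
  last by move=> b /andP[_ bj]; rewrite leqNgt bj.
rewrite [X in (_ + X)%N](eq_big_nat _ _ (F2 := fun=> 1)%N);
  last by move=> b /andP[-> _].
by rewrite !sum_nat_const_nat; case: ifP; lia.
Qed.

(** Since [lift] is increasing, deleting the last row and its column preserves the comparisons among
    the other columns. The remaining summand will be the length of the last block of [RE]. *)
Lemma mono_length_last (n d : nat) (c : 'I_n.+1 -> 'I_n.+1)
    (k : 'I_n.+1 -> 'I_d) (c' : 'I_n -> 'I_n) :
  injective c' ->
  (forall i, c (lift ord_max i) = lift (c ord_max) (c' i)) ->
  mono_length c k =
  (mono_length c' (k \o lift ord_max) +
   (k ord_max + if k ord_max == 0 :> nat then n - c ord_max
                else n + c ord_max))%N.
Proof.
move=> c'I cc; rewrite /mono_length.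
have below (i : nat) (F : 'I_n.+1 -> nat) : (i <= n)%N ->
    (\sum_(r < n.+1 | (r < i)%N) F r =
     \sum_(r < n | (r < i)%N) F (lift ord_max r))%N.
  move=> i_n.
  rewrite big_mkcond (bigD1_ord (P := predT) ord_max) //= ltnNge i_n.
  by rewrite add0n [RHS]big_mkcond; apply: eq_bigr => r _;
     rewrite /bump (leqNgt n) ltn_ord.
rewrite !(bigD1_ord (P := predT) ord_max) //= below //.
have -> : (\sum_(r < n | (r < n)%N)
     pair_cost (c (lift ord_max r)) (c ord_max) (k ord_max)
   = if k ord_max == 0 :> nat then n - c ord_max else n + c ord_max)%N.
  rewrite -sum_pair_cost_lift [RHS](reindex_inj c'I) /=.
  by apply: eq_big => [r|r _]; rewrite ?ltn_ord // cc.
rewrite [X in (_ + _ + (_ + X))%N](eq_bigr (fun i : 'I_n =>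
    \sum_(r < n | (r < i)%N) pair_cost (c' r) (c' i) (k (lift ord_max i)))%N).
  by rewrite addnACA addnC.
move=> i _; rewrite /bump (leqNgt n) ltn_ord add0n below; last exact: ltnW.
apply: eq_bigr => r _.
by rewrite !cc /pair_cost /= ltnNge leq_bump2 -ltnNge.
Qed.

(** * Coordinates on the group, and the lower bound on word length *)

Definition mono_mx (R : realType) (n d : nat) (c : 'I_n -> 'I_n)
    (k : 'I_n -> 'I_d) : 'M[R[i]]_n :=
  \matrix_(i, j) if j == c i then zeta R d ^+ k i else 0.

Lemma in_Gd1n_mono_mx (R : realType) (n d : nat) (w : 'M[R[i]]_n) :
  (0 < d)%N -> in_Gd1n d w ->
  exists c : 'I_n -> 'I_n, exists2 k : 'I_n -> 'I_d,
    injective c & w = mono_mx R c k.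
Proof.
move=> d0 [[rowP colP] rootP].
have /fin_all_exists[c cP] (i : 'I_n) :
    exists j, unique (fun j => w i j != 0) j.
  exact: rowP.
have /fin_all_exists[k kP] (i : 'I_n) :
    exists l : 'I_d, w i (c i) = zeta R d ^+ l.
  have [nz _] := cP i; have [l e] :=
    prim_rootP (zeta_prim R d0) (unity_rootP (rootP _ _ nz)).
  by exists l.
exists c, k.
  move=> i1 i2 c12; have [i0 [_ i0U]] := colP (c i1).
  have nz i : w i (c i) != 0 by case: (cP i).
  by rewrite -(i0U i1 (nz i1)); apply: i0U; rewrite c12.
apply/matrixP => i j; rewrite mxE; case: eqP => [->|nj]; first exact: kP.
apply/eqP/negPn/negP => nz; apply: nj; symmetry.
by case: (cP i) => _; apply.
Qed.

Lemma mono_mx1 (R : realType) (n d : nat) (k : 'I_n -> 'I_d) :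
  (forall i, k i = 0 :> nat)%N -> mono_mx R id k = 1.
Proof.
by move=> k0; apply/matrixP => i j; rewrite !mxE k0 eq_sym; case: (i == j).
Qed.

Definition mulz_exp (n d : nat) (d0 : (0 < d)%N) (k : 'I_n.+1 -> 'I_d)
    (i : 'I_n.+1) : 'I_d :=
  if i == ord0 then Ordinal (ltn_pmod (k i).+1 d0) else k i.

Lemma z_mx_mul_mono_mx (R : realType) (n d : nat) (d0 : (0 < d)%N)
    (c : 'I_n.+1 -> 'I_n.+1) (k : 'I_n.+1 -> 'I_d) :
  z_mx R d n.+1 *m mono_mx R c k = mono_mx R c (mulz_exp d0 k).
Proof.
rewrite mul_diag_mx; apply/matrixP => i j; rewrite !mxE /mulz_exp.
rewrite (_ : (i == 0%N :> nat) = (i == ord0)) //.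
case: ifP => _; last by rewrite mul1r.
by case: ifP => _; rewrite ?mulr0 //= (prim_expr_mod (zeta_prim R d0)) exprS.
Qed.

(** Letters are numbered from 1 and ordinals from 0, whence the index [q.+1] for the exchange of [p]
    and [q]. *)
Lemma s_mx_tperm (R : realType) (n : nat) (p q : 'I_n) :
  q = p.+1 :> nat -> s_mx R n q.+1 = perm_mx (tperm p q).
Proof.
move=> qp; apply/matrixP => i j; rewrite !mxE; congr (nat_of_bool _)%:R.
rewrite /= qp !eqSS.
case: tpermP => [->|->|/eqP ip /eqP iq]; rewrite -val_eqE /= ?qp ?eqxx.
- by rewrite eq_sym.
- by rewrite [X in if X then _ else _]gtn_eqF // eqSS eq_sym.
- move: ip iq; rewrite -!val_eqE /= qp => /negbTE-> /negbTE->.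
  by rewrite eqSS eq_sym.
Qed.

Lemma s_mx_mul_mono_mx (R : realType) (n d : nat) (p q : 'I_n)
    (c : 'I_n -> 'I_n) (k : 'I_n -> 'I_d) :
  q = p.+1 :> nat ->
  s_mx R n q.+1 *m mono_mx R c k =
  mono_mx R (c \o tperm p q) (k \o tperm p q).
Proof.
move=> qp; rewrite (s_mx_tperm _ qp) -row_permE.
by apply/matrixP => i j; rewrite !mxE.
Qed.

(** The lower bound: the induction peels off the leftmost letter, which acts on the rows of the
    matrix of the remaining word. *)
Lemma word_mx_mono_length (R : realType) (n d : nat) (v : word) :
  (0 < d)%N -> all (alphabet n.+1) v ->
  exists c : 'I_n.+1 -> 'I_n.+1, exists k : 'I_n.+1 -> 'I_d,
    [/\ injective c, word_mx R d n.+1 v = mono_mx R c k &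
        (mono_length c k <= size v)%N].
Proof.
move=> d0; elim: v => [_|l v IH] /=.
  exists id, (fun=> Ordinal d0); split=> //; last by rewrite mono_length_id.
  by rewrite /word_mx big_nil mono_mx1.
case/andP=> ln /IH[c [k [cI e le]]].
have -> : word_mx R d n.+1 (l :: v) = letter_mx R d n.+1 l *m mono_mx R c k.
  by rewrite /word_mx big_cons -/(word_mx _ _ _ _) e.
case: l ln => [_|j /= /andP[j2 jn]].
  exists c, (mulz_exp d0 k); split=> //; first exact: z_mx_mul_mono_mx.
  apply: leq_trans (mono_length_row0 c (k := k) _ _) _ => //.
    by move=> i /negbTE i0; rewrite /mulz_exp i0.
  (* Reduction modulo [d] can only lower the incremented exponent. *)
  by rewrite /mulz_exp eqxx /=; exact: leq_mod.
have pn : (j.-2 < n.+1)%N by lia.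
have qn : (j.-1 < n.+1)%N by lia.
have qp : Ordinal qn = (Ordinal pn).+1 :> nat by move=> /=; lia.
exists (c \o tperm (Ordinal pn) (Ordinal qn)),
  (k \o tperm (Ordinal pn) (Ordinal qn)).
split; first by move=> x y /cI /perm_inj.
  by rewrite -s_mx_mul_mono_mx //= prednK //; lia.
by apply: leq_trans (mono_length_tperm _ cI qp) _.
Qed.

(** * Embedding of size [n] into size [n.+1] *)

(** The block diagonal matrix with blocks [A] and 1, written entrywise so that its size is literally
    [n.+1]. *)
Definition emb_mx (C : fieldType) (n : nat) (A : 'M[C]_n) : 'M[C]_n.+1 :=
  \matrix_(p, q) match unlift ord_max p, unlift ord_max q with
    | Some p', Some q' => A p' q'
    | None, None => 1
    | _, _ => 0
    end.

Lemma emb_mxE (C : fieldType) (n : nat) (A : 'M[C]_n) :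
  [/\ forall p q, emb_mx A (lift ord_max p) (lift ord_max q) = A p q,
      forall p, emb_mx A (lift ord_max p) ord_max = 0,
      forall q, emb_mx A ord_max (lift ord_max q) = 0 &
      emb_mx A ord_max ord_max = 1].
Proof. by split=> *; rewrite mxE ?liftK ?unlift_none. Qed.

Lemma matrix_lastP (C : fieldType) (n : nat) (A B : 'M[C]_n.+1) :
  (forall p q, A (lift ord_max p) (lift ord_max q) =
               B (lift ord_max p) (lift ord_max q)) ->
  (forall p, A (lift ord_max p) ord_max = B (lift ord_max p) ord_max) ->
  (forall q, A ord_max (lift ord_max q) = B ord_max (lift ord_max q)) ->
  A ord_max ord_max = B ord_max ord_max -> A = B.
Proof.
move=> eLL eLM eML eMM; apply/matrixP => p q.
by case: (unliftP ord_max p) => [p' ->|->];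
  case: (unliftP ord_max q) => [q' ->|->].
Qed.

Lemma emb_mx1 (C : fieldType) (n : nat) : emb_mx 1 = 1 :> 'M[C]_n.+1.
Proof.
have [eLL eLM eML eMM] := emb_mxE (1 : 'M[C]_n).
apply: matrix_lastP => *; rewrite ?eLL ?eLM ?eML ?eMM !mxE ?eqxx //.
- by rewrite (inj_eq (@lift_inj _ _)).
- by rewrite eq_sym (negbTE (neq_lift _ _)).
- by rewrite (negbTE (neq_lift _ _)).
Qed.

Lemma emb_mxM (C : fieldType) (n : nat) (A B : 'M[C]_n) :
  emb_mx (A *m B) = emb_mx A *m emb_mx B.
Proof.
have [aLL aLM aML aMM] := emb_mxE A; have [bLL bLM bML bMM] := emb_mxE B.
have [eLL eLM eML eMM] := emb_mxE (A *m B).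
apply: matrix_lastP => *; rewrite ?eLL ?eLM ?eML ?eMM [in RHS]mxE;
  rewrite (bigD1_ord (P := predT) ord_max) //=.
- rewrite aLM mul0r add0r mxE; apply: eq_bigr => r _; by rewrite aLL bLL.
- by rewrite aLM mul0r add0r big1 // => r _; rewrite bLM mulr0.
- by rewrite bML mulr0 add0r big1 // => r _; rewrite aML mul0r.
- by rewrite aMM bMM mulr1 big1 ?addr0 // => r _; rewrite aML mul0r.
Qed.

Lemma emb_z_mx (R : realType) (d n : nat) :
  emb_mx (z_mx R d n.+1) = z_mx R d n.+2.
Proof.
have [eLL eLM eML eMM] := emb_mxE (z_mx R d n.+1).
apply: matrix_lastP => [p q|p|q|]; rewrite ?eLL ?eLM ?eML ?eMM !mxE.
- by rewrite (inj_eq (@lift_inj _ _)) lift_max.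
- by rewrite [lift _ _ == _]eq_sym (negbTE (neq_lift _ _)).
- by rewrite (negbTE (neq_lift _ _)).
- by rewrite eqxx.
Qed.

Lemma emb_s_mx (R : realType) (n j : nat) :
  (1 < j <= n)%N -> emb_mx (s_mx R n j) = s_mx R n.+1 j.
Proof.
move=> jn; have [eLL eLM eML eMM] := emb_mxE (s_mx R n j).
apply: matrix_lastP => [p q|p|q|];
  rewrite ?eLL ?eLM ?eML ?eMM !mxE ?lift_max //=.
- have /= pn := ltn_ord p; rewrite gtn_eqF //.
  by case: (p.+1 =P j.-1) => ?; [|case: eqP => ?]; lia.
- have /= qn := ltn_ord q; rewrite [n.+1 == j.-1]gtn_eqF; last lia.
  by rewrite [n.+1 == j]gtn_eqF ?[q.+1 == _]ltn_eqF //; lia.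
- rewrite [n.+1 == j.-1]gtn_eqF; last lia.
  by rewrite [n.+1 == j]gtn_eqF ?eqxx //; lia.
Qed.

(** Letters of the smaller alphabet fix the last coordinate. This lets a word for the minor be read
    in the larger group. *)
Lemma emb_word_mx (R : realType) (d n : nat) (u : word) :
  all (alphabet n.+1) u ->
  emb_mx (word_mx R d n.+1 u) = word_mx R d n.+2 u.
Proof.
rewrite /word_mx; elim: u => [_|l u IH] /=; first by rewrite !big_nil emb_mx1.
case/andP=> ln /IH e; rewrite !big_cons -e emb_mxM; congr (_ * _).
by case: l ln => [_|j] /=; [exact: emb_z_mx|exact: emb_s_mx].
Qed.

(** * Matrices of the words composing a block *)

(** Column [q] is the basis vector of index [f q], counted from 0. With [f] on [nat], products
    become compositions that [lia] can check. *)
Definition idx_mx (C : fieldType) (n : nat) (f : nat -> nat) : 'M[C]_n :=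
  \matrix_(p, q) (p == f q :> nat)%:R.

Lemma mul_idx_mx (C : fieldType) (n : nat) (A : 'M[C]_n.+1) (f : nat -> nat) :
  (forall q, q <= n -> f q <= n)%N ->
  A *m idx_mx C n.+1 f = \matrix_(p, q) A p (inord (f q)).
Proof.
move=> fn; apply/matrixP => p q; rewrite !mxE (bigD1 (inord (f q))) //= mxE.
have fq : (f q < n.+1)%N by rewrite ltnS fn // -ltnS.
rewrite inordK // eqxx mulr1 big1 ?addr0 // => r /negP r_fq.
rewrite mxE; case: eqP => [e|_]; last by rewrite mulr0.
by case: r_fq; rewrite -val_eqE /= inordK // e.
Qed.

Lemma idx_mxM (C : fieldType) (n : nat) (f g h : nat -> nat) :
  (forall q, q <= n -> g q <= n)%N -> (forall q, q <= n -> f (g q) = h q)%N ->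
  idx_mx C n.+1 f *m idx_mx C n.+1 g = idx_mx C n.+1 h.
Proof.
move=> gn fg; rewrite mul_idx_mx //; apply/matrixP => p q; rewrite !mxE.
have qn : (q <= n)%N by rewrite -ltnS.
by rewrite inordK ?fg // ltnS gn.
Qed.

Lemma idx_mx1 (C : fieldType) (n : nat) (f : nat -> nat) :
  (forall q, q < n -> f q = q)%N -> idx_mx C n f = 1.
Proof. by move=> fq; apply/matrixP => p q; rewrite !mxE fq. Qed.

Lemma s_mx_idx (R : realType) (n j : nat) : (1 < j)%N ->
  s_mx R n j =
  idx_mx _ n (fun q => if q.+2 == j then q.+1 else
                  if q.+1 == j then q.-1 else q)%N.
Proof.
move=> j1; apply/matrixP => p q; rewrite !mxE /=; congr (nat_of_bool _)%:R.
by apply/eqP/eqP; do ?[case: eqP => ?]; lia.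
Qed.

Lemma s_up_rcons (a b : nat) : (a <= b.+1)%N ->
  s_up a b.+1 = rcons (s_up a b) (Ls b.+1).
Proof.
move=> ab; rewrite /s_up /index_iota subSn // -addn1 iotaD cats1.
by rewrite map_rcons subnKC.
Qed.

Lemma s_down_cons (a b : nat) : (a <= b.+1)%N ->
  s_down b.+1 a = Ls b.+1 :: s_down b a.
Proof. by move=> ab; rewrite /s_down s_up_rcons // rev_rcons. Qed.

Lemma s_up_nil (a b : nat) : (b < a)%N -> s_up a b = [::].
Proof. by rewrite /s_up /index_iota -subn_eq0 => /eqP->. Qed.

Lemma size_s_up (a b : nat) : size (s_up a b) = (b.+1 - a)%N.
Proof. by rewrite size_map size_iota. Qed.

Lemma size_s_down (a b : nat) : size (s_down b a) = (b.+1 - a)%N.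
Proof. by rewrite size_rev size_s_up. Qed.

Lemma all_alphabet_s_up (n a b : nat) :
  (1 < a)%N -> (b <= n)%N -> all (alphabet n) (s_up a b).
Proof.
move=> a1 bn; rewrite all_map; apply/allP => j; rewrite mem_index_iota /=.
by lia.
Qed.

Lemma all_alphabet_s_down (n a b : nat) :
  (1 < a)%N -> (b <= n)%N -> all (alphabet n) (s_down b a).
Proof. by move=> a1 bn; rewrite all_rev all_alphabet_s_up. Qed.

Lemma all_alphabet_z_pow (n k : nat) : all (alphabet n) (z_pow k).
Proof. by rewrite all_nseq orbT. Qed.

(** A cycle, obtained by peeling off the leftmost letter. The case [a = b.+1] is the empty word,
    which occurs when the last row has its entry 1 in the last column. *)
Lemma word_mx_s_down (R : realType) (d n a b : nat) :
  (1 < a)%N -> (a <= b.+1)%N -> (b <= n.+1)%N ->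
  word_mx R d n.+1 (s_down b a) =
  idx_mx _ n.+1 (fun q => if q.+2 == a then b.-1 else
                          if a <= q.+1 <= b then q.-1 else q)%N.
Proof.
move=> a1; elim: b => [|b IH] ab bn; first lia.
have [a_b|a_b] := leqP a b.+1; last first.
  rewrite /s_down s_up_nil // /word_mx big_nil idx_mx1 // => q qn.
  by case: eqP => [|_]; [lia|case: ifP; lia].
rewrite s_down_cons // /word_mx big_cons -/(word_mx _ _ _ _) IH //;
  last exact: ltnW.
rewrite /= s_mx_idx; last lia.
apply: idx_mxM => q qn; do ?[case: ifP]; lia.
Qed.

(** The opposite cycle on the first [b] indices; here the rightmost letter is peeled off. *)
Lemma word_mx_s_up2 (R : realType) (d n b : nat) :
  (0 < b)%N -> (b <= n.+1)%N ->
  word_mx R d n.+1 (s_up 2 b) =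
  idx_mx _ n.+1 (fun q => if q.+1 == b then 0 else
                          if q.+1 < b then q.+1 else q)%N.
Proof.
case: b => // b _; elim: b => [|b IH] bn.
  by rewrite s_up_nil // /word_mx big_nil idx_mx1 // => -[|q].
rewrite s_up_rcons // -cats1 /word_mx big_cat big_seq1 /=.
rewrite -/(word_mx _ _ _ _) IH //;
  last exact: ltnW.
rewrite s_mx_idx //.
apply: idx_mxM => q qn; do ?[case: ifP]; lia.
Qed.

Lemma word_mx_z_pow (R : realType) (d n k : nat) :
  word_mx R d n (z_pow k) =
  diag_mx (\row_(j < n) if j == 0%N :> nat then zeta R d ^+ k else 1).
Proof.
rewrite /z_pow; elim: k => [|k IH].
  rewrite /word_mx big_nil; apply/matrixP => i j; rewrite !mxE.
  by case: ifP.
rewrite /word_mx big_cons -/(word_mx _ _ _ _) IH /= -mulmxE mulmx_diag.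
congr diag_mx; apply/rowP => j; rewrite !mxE.
by case: ifP => _; rewrite ?mulr1 // exprS.
Qed.

(** * The blocks of [RE], its value and its length *)

Lemma last_row_col_mono_mx (R : realType) (n d : nat) (c : 'I_n.+1 -> 'I_n.+1)
    (k : 'I_n.+1 -> 'I_d) :
  last_row_col (mono_mx R c k) = c ord_max.
Proof.
have d0 := leq_ltn_trans (leq0n _) (ltn_ord (k ord_max)).
have z0 : zeta R d != 0.
  by rewrite (prim_root_eq0 (zeta_prim R d0)) -lt0n.
rewrite /last_row_col; case: pickP => [j|/(_ (c ord_max))] /=; rewrite mxE.
  by case: (j =P c ord_max) => [->|_] //; rewrite eqxx.
by rewrite eqxx expf_eq0 (negbTE z0) andbF.
Qed.

(* Whatever its shape, right multiplication by the block moves the last column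
   to column [c ord_max], keeping the order of the others, and scales it by the
   last entry. *)
Lemma word_mx_RE_block (R : realType) (n d : nat) (c : 'I_n.+2 -> 'I_n.+2)
    (k : 'I_n.+2 -> 'I_d) :
  let B := word_mx R d n.+2 (RE_block d (mono_mx R c k)) in
  [/\ forall p, B p (c ord_max) =
                if p == ord_max then zeta R d ^+ k ord_max else 0 &
      forall p q, B p (lift (c ord_max) q) = (p == lift ord_max q)%:R].
Proof.
rewrite /RE_block last_row_col_mono_mx /=. rewrite mxE eqxx zeta_logX.
set j := c ord_max; set x := k ord_max.
have d0 := leq_ltn_trans (leq0n _) (ltn_ord x).
have jn := ltn_ord j.
have bumpn (q : 'I_n.+1) : bump n.+1 q = q by rewrite /bump leqNgt ltn_ord.
have -> : (zeta R d ^+ x == 1) = (x == 0 :> nat).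
  by rewrite -(prim_order_dvd (zeta_prim R d0)) /dvdn modn_small.
have [x0|x0] := eqVneq (x : nat) 0%N.
  rewrite word_mx_s_down // x0 expr0; split=> [p|p q]; rewrite mxE.
    by rewrite eqxx -val_eqE /=; case: (_ == _).
  rewrite -val_eqE /= bumpn /bump; congr (nat_of_bool (_ == _))%:R.
  by have := ltn_ord q; do 2?[case: ifP]; case: (leqP j q); rewrite /=; lia.
(* For the first column the ascending word is empty, so both shapes with a power of [z] coincide. *)
have -> : (if j.+1 == 1%N then s_down n.+2 2 ++ z_pow x
           else s_down n.+2 2 ++ z_pow x ++ s_up 2 j.+1) =
          s_down n.+2 2 ++ z_pow x ++ s_up 2 j.+1.
  by case: eqP => // ->; rewrite s_up_nil ?cats0.
rewrite /word_mx !big_cat /= -!/(word_mx _ _ _ _) word_mx_s_down //.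
rewrite word_mx_z_pow word_mx_s_up2 //.
rewrite mulrA -!mulmxE mul_mx_diag mul_idx_mx; last first.
  by move=> q qn; do ?[case: ifP]; lia.
split=> [p|p q]; rewrite !mxE.
  rewrite eqxx inordK //= -val_eqE /=; case: (_ == _); by rewrite ?mul1r ?mul0r.
have qn := ltn_ord q.
(* On either side of [j], the ascending cycle sends the column to [q.+1], which the power of [z]
   fixes and the descending cycle brings back to [q]. *)
have e : (if (lift j q).+1 == j.+1 then 0 else
         if (lift j q).+1 < j.+1 then (lift j q).+1 else lift j q)%N = q.+1.
  rewrite /= /bump; case: (leqP j q) => /= ?; do ?[case: ifP]; lia.
by rewrite e inordK //= mulr1 -val_eqE /= bumpn ltnS qn.
Qed.

(** Induction on the size: [w] is the embedded minor times the matrix of the last block, and that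
    block has the length by which [mono_length] grows. *)
Lemma RE_mono_mx (R : realType) (n d : nat) (c : 'I_n.+1 -> 'I_n.+1)
    (k : 'I_n.+1 -> 'I_d) :
  injective c ->
  represents d (RE d (mono_mx R c k)) (mono_mx R c k) /\
  size (RE d (mono_mx R c k)) = mono_length c k.
Proof.
elim: n c k => [|n IH] c k cI.
  rewrite /= mxE (ord1 (c ord0)) eqxx zeta_logX; split.
    split; first exact: all_alphabet_z_pow.
    rewrite word_mx_z_pow; apply/matrixP => i j.
    by rewrite !mxE (ord1 i) (ord1 j) (ord1 (c ord0)) !eqxx.
  by rewrite size_nseq /mono_length !big_ord1 big1 ?addn0.
(* By injectivity the other rows avoid column [c ord_max]; [c'] is their column function once that
   column is deleted. *)
have /fin_all_exists[c' cc] (i : 'I_n.+1) :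
    exists j, c (lift ord_max i) = lift (c ord_max) j.
  case: (unliftP (c ord_max) (c (lift ord_max i))) => [j ->|/cI /eqP].
    by exists j.
  by rewrite eq_sym (negbTE (neq_lift _ _)).
have c'I : injective c'.
  by move=> i j e; apply: (@lift_inj _ ord_max); apply: cI; rewrite !cc e.
set w := mono_mx R c k; set w' := mono_mx R c' (k \o lift ord_max).
have minor : row' ord_max (col' (last_row_col w) w) = w'.
  rewrite last_row_col_mono_mx; apply/matrixP => i j.
  by rewrite !mxE cc (inj_eq (@lift_inj _ _)).
have REw : RE d w = RE d w' ++ RE_block d w by rewrite -minor.
have [[alph eqw'] szw'] := IH c' (k \o lift ord_max) c'I.
have [Bc Bl] := word_mx_RE_block R c k.
have nk := ltn_ord (c ord_max).
rewrite REw; split; [split|].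
- rewrite all_cat; apply/andP; split.
    apply: sub_all alph => -[|j] //=; lia.
  rewrite /RE_block; do ?[case: ifP => _]; rewrite ?all_cat;
    by rewrite ?all_alphabet_z_pow ?all_alphabet_s_up ?all_alphabet_s_down.
- rewrite /word_mx big_cat /= -!/(word_mx _ _ _ _) -emb_word_mx // eqw' -/w'.
  have [eLL eLM eML eMM] := emb_mxE w'.
  apply/matrixP => p q; rewrite mxE [RHS]mxE.
  (* Each column of the block matrix has a single nonzero entry, so the product reduces to one
     term. *)
  case: (unliftP (c ord_max) q) => [q' ->|->].
    rewrite (bigD1 (lift ord_max q')) //= Bl eqxx mulr1 big1 ?addr0; last first.
      by move=> r /negbTE rq; rewrite Bl rq mulr0.
    case: (unliftP ord_max p) => [p' ->|->].
      by rewrite eLL mxE cc (inj_eq (@lift_inj _ _)).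
    by rewrite eML eq_sym (negbTE (neq_lift _ _)).
  rewrite (bigD1 ord_max) //= Bc eqxx big1 ?addr0; last first.
    by move=> r /negbTE rq; rewrite Bc rq mulr0.
  case: (unliftP ord_max p) => [p' ->|->].
    by rewrite eLM mul0r cc (negbTE (neq_lift _ _)).
  by rewrite eMM mul1r eqxx.
rewrite size_cat szw' (mono_length_last k c'I cc); congr (_ + _)%N.
rewrite /RE_block last_row_col_mono_mx mxE eqxx zeta_logX.
have d0 := leq_ltn_trans (leq0n _) (ltn_ord (k ord_max)).
rewrite -(prim_order_dvd (zeta_prim R d0)) /dvdn modn_small //.
case: (eqVneq (k ord_max : nat) 0%N) => [->|_].
  by rewrite size_s_down; lia.
by case: ifP => /eqP; rewrite !size_cat ?size_s_down ?size_nseq ?size_s_up; lia.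
Qed.

Theorem mainTheorem4 (R : realType) (d n : nat) (hd : (1 < d)%N)
    (hn : (2 <= n)%N) (w : 'M[R[i]]_n) (hw : in_Gd1n d w) :
  reduced_expression d (RE d w) w.
Proof.
have d0 := ltnW hd; case: n hn w hw => // n _ w hw.
have [c [k cI ew]] := in_Gd1n_mono_mx d0 hw; rewrite {}ew {w hw}.
have [rep _] := RE_mono_mx R k cI; split=> // v [alph ev].
have [c1 [k1 [cI1 e1 le1]]] := word_mx_mono_length R d0 alph.
(* [RE] depends only on the matrix, so the length formula is applied to the coordinates [c1], [k1]
   obtained from [v]. *)
by apply: leq_trans le1; have [_ <-] := RE_mono_mx R k1 cI1; rewrite -e1 ev.
Qed.
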